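(* Let $n\ge 2$, let $\hbar,\theta,\eta$ be real numbers and let $\Sigma\in S^{2n}$ be a real symmetric $2n\times 2n$ matrix (the symmetric part $\Sigma_{W_\Omega}$ of the covariance matrix). Let $\Omega(\hbar,\theta,\eta)=f(\hbar,\theta,\eta)J+S(\theta,\eta)$, and write $\mathrm{Cov}(\hbar,\theta,\eta)=\Sigma+\frac{i}{2}\Omega(\hbar,\theta,\eta)$. Then the following hold. (i) The matrix $\Sigma+\frac{i}{2}\Omega(\hbar,\theta,\eta)$ has real eigenvalues. (ii) If there exist real numbers $\hbar,\theta,\eta\neq 0$ such that $S(\theta,\eta)$ is symplectic or anti-symplectic, and the covariance matrix $\mathrm{Cov}(\hbar,\theta,\eta)$ is positive semi-definite, then $\Sigma\in S^{2n}_{++}$, i.e. $\Sigma$ is positive definite, and (writing $f(\hbar,\theta)$ and $\mathrm{Cov}(\hbar,\theta)$ since $\eta$ is then determined by $\theta$) $\mathrm{Cov}(\hbar',\theta')\succeq 0$ for all $\hbar'\le\hbar$, $\theta'\le\theta$, as long as $f(\hbar,\theta)$ is a homogeneous function of degree one.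
   Context: $S^{2n}$ denotes the real symmetric $2n\times 2n$ matrices and $S^{2n}_{++}$ the positive definite ones. $J=\begin{pmatrix}0&I_n\\-I_n&0\end{pmatrix}$. The function $f$ is real-valued, and $S(\theta,\eta)=\begin{pmatrix}\theta E&0\\0&\eta E'\end{pmatrix}$, where $E,E'$ are constant real skew-symmetric $n\times n$ matrices. The extended Heisenberg-Weyl algebra is $[\hat z_\alpha,\hat z_\beta]=i\,\Omega_{\alpha\beta}\hat I$, $\alpha,\beta=1,\dots,2n$. It is obtained from the Heisenberg-Weyl algebra $[\hat Z_\alpha,\hat Z_\beta]=i g J_{\alpha\beta}\hat I$ by $\hat z=M\hat Z$ with $M\in GL(2n,\mathbb{R})$ and $g$ a nonzero real number (depending on the parameters), so that $\Omega(\hbar,\theta,\eta)=g\,MJM^{\intercal}$; in particular $\Omega(\hbar,\theta,\eta)$ is invertible. For a state with density operator $\hat\rho$, the quantum mechanical covariance matrix is $\Sigma_{W_\Omega}+\frac i2\Omega$, where $\left(\Sigma_{W_\Omega}\right)_{\alpha\beta}=\frac12\mathrm{Tr}(\hat\rho\{\hat z_\alpha,\hat z_\beta\})-\mathrm{Tr}(\hat\rho\hat z_\alpha)\mathrm{Tr}(\hat\rho\hat z_\beta)$. The matrix $\Sigma$ is kept fixed when the parameters $(\hbar,\theta)$ are replaced by $(\hbar',\theta')$. ''$S$ is symplectic'' or ''$S$ is anti-symplectic'' is understood up to the overall scale $\theta$: $S=\theta S_0$ with $S_0^{\intercal}JS_0=J$ (symplectic) or $S_0^{\intercal}JS_0=-J$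 (anti-symplectic). Concretely, $S=\theta\begin{pmatrix}E&0\\0&E\end{pmatrix}$ in the symplectic case and $S=\theta\begin{pmatrix}E&0\\0&-E\end{pmatrix}$ in the anti-symplectic case, with $E$ skew-symmetric and orthogonal.
   Formalization: The range ''for all ħ' ≤ ħ, θ' ≤ θ'' is replaced by joint scaling (ħ',θ') = l(ħ,θ) with |l| ≤ 1, since the claim as written is false (e.g. f = ħ with ħ' very negative, or f = 2ħ³/θ² with only θ reduced). *)

(* Defs.v *)
From HB Require Import structures.
From mathcomp Require Import all_boot all_order all_algebra.
From mathcomp Require Import reals complex.

Set Implicit Arguments.
Unset Strict Implicit.
Unset Printing Implicit Defensive.

Import Order.TTheory GRing.Theory Num.Theory.
Local Open Scope sesquilinear_scope.
Local Open Scope ring_scope.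
Local Open Scope complex_scope.

Section Defs.
Context {R : realType} {n : nat}.

Definition Jmx : 'M[R]_(n + n) := block_mx 0 1%:M (- 1%:M) 0.

Definition Smx (E E' : 'M[R]_n) (theta eta : R) : 'M[R]_(n + n) :=
  block_mx (theta *: E) 0 0 (eta *: E').

Definition Omega (f : R -> R -> R -> R) (E E' : 'M[R]_n) (hbar theta eta : R) :
    'M[R]_(n + n) :=
  f hbar theta eta *: Jmx + Smx E E' theta eta.

Definition Cov (Sigma : 'M[R]_(n + n)) (f : R -> R -> R -> R) (E E' : 'M[R]_n)
    (hbar theta eta : R) : 'M[R[i]]_(n + n) :=
  map_mx (real_complex R) Sigma
    + ('i%R / 2) *: map_mx (real_complex R) (Omega f E E' hbar theta eta).

(* The commutation relations [z_a, z_b] = i W_ab come from the canonical ones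
   [Z_a, Z_b] = i g J_ab through an invertible linear change z = M Z. *)
Definition HW_form (W : 'M[R]_(n + n)) : Prop :=
  exists (g : R) (M : 'M[R]_(n + n)),
    [/\ g != 0, M \in unitmx & W = g *: (M *m Jmx *m M^T)].

Definition symplectic (S0 : 'M[R]_(n + n)) : Prop :=
  S0^T *m Jmx *m S0 = Jmx.

Definition antisymplectic (S0 : 'M[R]_(n + n)) : Prop :=
  S0^T *m Jmx *m S0 = - Jmx.

Definition up_to_scale (P : 'M[R]_(n + n) -> Prop) (theta : R)
    (S : 'M[R]_(n + n)) : Prop :=
  exists2 S0, P S0 & S = theta *: S0.

(* [etaf] expresses eta as a function of theta along the (anti-)symplectic
   family.  It is unique: a skew E that occurs in an (anti-)symplectic
   S theta eta with theta != 0 is invertible, which forces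
   etaf t = (eta / theta) * t. *)
Definition eta_determined (E E' : 'M[R]_n) (etaf : R -> R) : Prop :=
  (forall t, up_to_scale symplectic t (Smx E E' t (etaf t))) \/
  (forall t, up_to_scale antisymplectic t (Smx E E' t (etaf t))).

End Defs.

Definition homogeneous1 {R : realType} (phi : R -> R -> R) : Prop :=
  forall t x y : R, phi (t * x) (t * y) = t * phi x y.

Definition posdef {R : realType} {m : nat} (A : 'M[R]_m) : Prop :=
  A \is symmetricmx /\
  forall v : 'cV[R]_m, v != 0 -> 0 < (v^T *m A *m v) 0 0.

(* The order of R[i] is partial: 0 <= z means that z is real and nonnegative. *)
Definition psd {R : realType} {m : nat} (A : 'M[R[i]]_m) : Prop :=
  A \is hermsymmx /\
  forall v : 'cV[R[i]]_m, 0 <= (v ^t* *m A *m v) 0 0.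

(* When (x, y) != 0 this says (x', y') = (l x, l y) with |l| <= 1: no parameter
   grows in absolute value and the ratio x : y is kept.  The ratio cannot be
   dropped: homogeneity relates the values of a function only along lines
   through the origin. *)
Definition shrinks {R : realType} (x' y' x y : R) : Prop :=
  [/\ `|x'| <= `|x|, `|y'| <= `|y| & x' * y = x * y'].

(* Main.v *)
(* For real S = S^T and W = -W^T, the Hermitian form of S + (i/2) W at u + i w
   equals S(u,u) + S(w,w) - W(u,w).  If S(u,u) = 0, rescaling u forces
   W(u,w) = 0 for every w, hence u = 0 when W is invertible: positive
   semi-definiteness of S + (i/2) W makes S positive definite.  Changing w to -w
   gives |W(u,w)| <= S(u,u) + S(w,w), which survives the replacement of W by
   l W with |l| <= 1.  Comparing (anti-)symplecticity of Smx t (eta t) at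
   different t shows that eta is linear, so shrinking the parameters replaces
   Omega by l Omega. *)
Require Import Defs.
From HB Require Import structures.
From mathcomp Require Import all_boot all_order all_algebra.
From mathcomp Require Import reals complex.
From mathcomp Require Import ring lra.

Set Implicit Arguments.
Unset Strict Implicit.
Unset Printing Implicit Defensive.

Import Order.TTheory GRing.Theory Num.Theory.
Local Open Scope sesquilinear_scope.
Local Open Scope ring_scope.
Local Open Scope complex_scope.

(** * Hermitian matrices and forms over a closed field *)

Lemma hermsym_eigenvalue_real (C : numClosedFieldType) (m : nat) (A : 'M[C]_m)
    (a : C) :
  A \is hermsymmx -> eigenvalue A a -> a \is Num.real.
Proof.
move=> /is_hermitianmxP; rewrite expr0 scale1r => hA /eigenvalueP[v hv v0].
have d0 : dotmx v v != 0 by rewrite dnorm_eq0.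
(* The same scalar is [a] times a nonzero real norm and, [A] being Hermitian, its own conjugate;
   cancelling the norm makes [a] real. *)
have hz : (v *m A *m v ^t*) 0 0 = a * dotmx v v.
  by rewrite hv -scalemxAl mxE dotmxE.
have hzC : ((v *m A *m v ^t*) 0 0)^*%R = (v *m A *m v ^t*) 0 0.
  have -> : ((v *m A *m v ^t*) 0 0)^*%R = ((v *m A *m v ^t*) ^t*) 0 0.
    by rewrite !mxE.
  rewrite !trmx_mul !map_mxM /= trmxCK.
  by rewrite -hA -[in RHS]mulmxA.
have dR : dotmx v v \is Num.real by rewrite ger0_real ?dnorm_ge0.
rewrite CrealE; apply/eqP/(mulIf d0); rewrite -{1}(conj_Creal dR) -rmorphM -hz.
exact: hzC.
Qed.

Lemma conj_rect (C : numClosedFieldType) (x y : C) :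
  x \is Num.real -> y \is Num.real -> (x + 'i * y)^*%R = x - 'i * y.
Proof.
by move=> xR yR; rewrite rmorphD rmorphM /= conjCi mulNr !conj_Creal.
Qed.

(** The rows [ut], [wt] will be the transposes of [u], [w]. Leaving them independent makes this pure
    bilinearity, with no symmetry or conjugation involved. *)
Lemma form_rect (C : numClosedFieldType) (m : nat) (ut wt : 'rV[C]_m)
    (A B : 'M[C]_m) (u w : 'cV[C]_m) :
  let F X (a : 'rV[C]_m) (b : 'cV[C]_m) := (a *m X *m b) 0 0 in
  ((ut - 'i *: wt) *m (A + ('i / 2) *: B) *m (u + 'i *: w)) 0 0
    = F A ut u + F A wt w + 'i * (F A ut w - F A wt u)
      + 'i / 2 * (F B ut u + F B wt w) - (F B ut w - F B wt u) / 2.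
Proof.
move=> F.
have E X a b : (a *m X *m b) 0 0 = F X a b by [].
have addE (M N : 'M[C]_1) : (M + N) 0 0 = M 0 0 + N 0 0 by rewrite mxE.
have oppE (M : 'M[C]_1) : (- M) 0 0 = - M 0 0 by rewrite mxE.
have scaleE c (M : 'M[C]_1) : (c *: M) 0 0 = c * M 0 0 by rewrite mxE.
rewrite mulmxDr -scalemxAr !mulmxBl !mulmxDr !mulmxDl.
rewrite -!scalemxAr -!scalemxAl.
rewrite !(addE, oppE, scaleE) !E.
(* With the square of ['i] left symbolic, [field] can treat ['i] as an indeterminate. *)
transitivity (F A ut u - 'i ^+ 2 * F A wt w + 'i * (F A ut w - F A wt u)
  + 'i / 2 * (F B ut u - 'i ^+ 2 * F B wt w)
  + 'i ^+ 2 * (F B ut w - F B wt u) / 2); first by field.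
by rewrite sqrCi; field.
Qed.

(** * Real bilinear forms and their complexification *)

Section HermitianForm.
Variables (K : realFieldType) (m : nat).
Implicit Types (S W A : 'M[K]_m) (u w : 'cV[K]_m).

Definition bform A u w : K := (u^T *m A *m w) 0 0.

Lemma bform_tr A u w : bform A^T u w = bform A w u.
Proof.
have -> : bform A^T u w = (u^T *m A^T *m w)^T 0 0 by rewrite mxE.
by rewrite !trmx_mul !trmxK mulmxA.
Qed.

Lemma bformZ A c u w : bform (c *: A) u w = c * bform A u w.
Proof. by rewrite /bform -scalemxAr -scalemxAl mxE. Qed.

Lemma bformZl A c u w : bform A (c *: u) w = c * bform A u w.
Proof. by rewrite /bform linearZ /= -!scalemxAl mxE. Qed.

Lemma bformZr A c u w : bform A u (c *: w) = c * bform A u w.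
Proof. by rewrite /bform -!scalemxAr mxE. Qed.

Lemma bformNr A u w : bform A u (- w) = - bform A u w.
Proof. by rewrite /bform mulmxN mxE. Qed.

Lemma bformNl A u w : bform A (- u) w = - bform A u w.
Proof. by rewrite /bform [(- u)^T]linearN /= !mulNmx mxE. Qed.

Lemma bform_skew W u w : W^T = - W -> bform W u w = - bform W w u.
Proof. by move=> hW; rewrite -bform_tr hW -scaleN1r bformZ mulN1r. Qed.

Lemma bform_skew_diag W u : W^T = - W -> bform W u u = 0.
Proof. by move=> hW; have := bform_skew u u hW; lra. Qed.

Lemma symmetricmxT S : S \is symmetricmx -> S^T = S.
Proof.
move=> /is_hermitianmxP; rewrite expr0 scale1r => h.
by rewrite {2}h map_mx_id.
Qed.

Lemma skewmxT W : W \is skewmx -> W^T = - W.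
Proof.
move=> /is_hermitianmxP; rewrite expr1 scaleN1r => h.
by rewrite {2}h opprK map_mx_id.
Qed.

Variables (C : numClosedFieldType) (phi : {rmorphism K -> C}).
Hypothesis phi_real : forall x, phi x \is Num.real.

Lemma hermitian_of_hermsym S W : S^T = S -> W^T = - W ->
  map_mx phi S + ('i / 2) *: map_mx phi W \is hermsymmx.
Proof.
move=> hS hW; apply/is_hermitianmxP; rewrite expr0 scale1r.
apply/matrixP=> i j; rewrite !mxE -!mulrA conj_rect //; last first.
  by rewrite realM ?realV ?realn.
have -> : W j i = - W i j by have /matrixP/(_ i j) := hW; rewrite !mxE.
have -> : S j i = S i j by have /matrixP/(_ i j) := hS; rewrite !mxE.
by rewrite rmorphN !mulrN opprK.
Qed.

(** Symmetry of [S] cancels the imaginary cross terms, skewness of [W] kills its diagonal terms, and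
    its two cross terms are equal halves of [- bform W u w]. *)
Lemma hermitian_form S W u w : S^T = S -> W^T = - W ->
  let v := map_mx phi u + 'i *: map_mx phi w in
  (v ^t* *m (map_mx phi S + ('i / 2) *: map_mx phi W) *m v) 0 0
    = phi (bform S u u + bform S w w - bform W u w).
Proof.
move=> hS hW v.
have -> : v ^t* = map_mx phi u^T - 'i *: map_mx phi w^T.
  by apply/matrixP=> i j; rewrite !mxE conj_rect.
have e A a b : (map_mx phi a^T *m map_mx phi A *m map_mx phi b) 0 0
    = phi (bform A a b).
  by rewrite -!map_mxM mxE.
have hSwu : bform S w u = bform S u w by rewrite -{1}hS bform_tr.
rewrite form_rect !e (bform_skew w u hW) !(bform_skew_diag _ hW) hSwu.
rewrite rmorphN rmorph0 rmorphB rmorphD.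
by field.
Qed.

End HermitianForm.

Lemma real_complex_real (R : rcfType) (x : R) : x%:C \is Num.real.
Proof. by rewrite complex_real. Qed.

(** * Positive semi-definiteness as a real inequality *)

Section PositiveSemidefinite.
Variables (R : realType) (m : nat).
Implicit Types (S W : 'M[R]_m) (u w : 'cV[R]_m).

Definition hermitian_of S W : 'M[R[i]]_m :=
  map_mx (real_complex R) S + ('i%R / 2) *: map_mx (real_complex R) W.

Lemma psd_hermitian_of S W : S^T = S -> W^T = - W ->
  psd (hermitian_of S W) <->
  (forall u w, 0 <= bform S u u + bform S w w - bform W u w).
Proof.
move=> hS hW; have form u w := hermitian_form (@real_complex_real R) u w hS hW.
split=> [[_ h] u w | h]; first by rewrite -lecR -form; exact: h.
split; first exact: (hermitian_of_hermsym (@real_complex_real R)).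
move=> v.
(* Real and imaginary parts of [v] serve as [u] and [w]. *)
have -> : v = map_mx (real_complex R) (map_mx (@complex.Re R) v)
    + 'i%R *: map_mx (real_complex R) (map_mx (@complex.Im R) v).
  by apply/matrixP=> i j; rewrite !mxE -complexiE; case: (v i j)=> a b; simpc.
rewrite form lecR; exact: h.
Qed.

Lemma psd_hermitian_of_posdef S W :
  S \is symmetricmx -> W^T = - W -> W \in unitmx -> psd (hermitian_of S W) ->
  posdef S.
Proof.
move=> symS hW Wunit; have hS := symmetricmxT symS.
move=> /(psd_hermitian_of hS hW) h; split=> // v v0.
have qv_ge0 : 0 <= bform S v v.
  by have := h v v; rewrite (bform_skew_diag v hW); lra.
rewrite -/(bform S v v) lt_def qv_ge0 andbT; apply: contra_neq v0 => qv0.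
have Wv0 w : bform W v w = 0.
  apply/eqP/negPn/negP => b0.
  (* The factor makes the [W] term equal to [bform S w w + 1]; as [bform S v v] vanishes, the form
     takes the value -1. *)
  have := h ((bform S w w + 1) / bform W v w *: v) w.
  rewrite !bformZl bformZr divfK // qv0 !mulr0.
  by rewrite leNgt; case/negP; lra.
have vW : v^T *m W = 0.
  apply/rowP=> j; have := Wv0 (delta_mx j 0).
  by rewrite /bform -colE !mxE.
by apply/trmx_inj; rewrite trmx0 -(mulmxK Wunit v^T) vW mul0mx.
Qed.

Lemma psd_hermitian_of_scale S W (l : R) :
  S^T = S -> W^T = - W -> `|l| <= 1 ->
  psd (hermitian_of S W) -> psd (hermitian_of S (l *: W)).
Proof.
move=> hS hW l1 /(psd_hermitian_of hS hW) h; apply/(psd_hermitian_of hS).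
  by rewrite linearZ /= hW scalerN.
move=> u w; have hp := h u w; have := h u (- w).
rewrite bformNl !bformNr opprK bformZ => hm.
have : `|l * bform W u w| <= bform S u u + bform S w w.
  rewrite normrM (le_trans (ler_piMl (normr_ge0 _) l1)) // ler_norml.
  by apply/andP; split; lra.
by rewrite ler_norml => /andP[]; lra.
Qed.

End PositiveSemidefinite.

(** * The commutation matrix and its scaling *)

Section Omega.
Variables (R : realType) (n : nat).
Implicit Types (E : 'M[R]_n) (f : R -> R -> R -> R).

Lemma Omega_tr f E E' h t e : E^T = - E -> E'^T = - E' ->
  (Omega f E E' h t e)^T = - Omega f E E' h t e.
Proof.
move=> hE hE'; rewrite /Omega /Jmx /Smx linearD linearZ /= !tr_block_mx trmx0.
rewrite [(t *: E)^T]linearZ [(e *: E')^T]linearZ [(- 1%:M)^T]linearN /=.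
rewrite hE hE' trmx1 !scalerN.
by rewrite opprD -(scalerN (f h t e)) !opp_block_mx !oppr0 opprK.
Qed.

Lemma Jmx_unit : Jmx \in @unitmx R (n + n).
Proof.
suff /mulmx1_unit[] : (@Jmx R n) *m (- Jmx) = 1%:M by [].
rewrite /Jmx opp_block_mx mulmx_block !oppr0 opprK scalar_mx_block.
rewrite !(mulmx0, mul0mx, mul1mx, mulmxN, mulNmx).
by rewrite !(opprK, oppr0, addr0, add0r).
Qed.

Lemma HW_form_unit (W : 'M[R]_(n + n)) : HW_form W -> W \in unitmx.
Proof.
move=> [g [M [g0 Munit ->]]].
by rewrite unitmxZ ?unitfE // !unitmx_mul unitmx_tr Munit Jmx_unit.
Qed.

Lemma OmegaZ f E E' (l h t e : R) :
  f (l * h) (l * t) (l * e) = l * f h t e ->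
  Omega f E E' (l * h) (l * t) (l * e) = l *: Omega f E E' h t e.
Proof.
move=> hf; rewrite /Omega hf /Smx scalerDr scale_block_mx !scalerA !scaler0.
by [].
Qed.

Lemma Smx_form E E' t e :
  (Smx E E' t e)^T *m Jmx *m Smx E E' t e =
  block_mx 0 ((t * e) *: (E^T *m E')) (- ((t * e) *: (E'^T *m E))) 0.
Proof.
rewrite /Smx /Jmx tr_block_mx !mulmx_block !linearZ /= !trmx0.
rewrite !(mulmx0, mul0mx, mulmx1, addr0, add0r, mulmxN, mulNmx).
by rewrite -!scalemxAl !scaler0 !scalerN !scalerA (mulrC e).
Qed.

(** The upper right block of [Smx_form], read at one diagonal entry [k] of [E^T *m E'], gives
    [x * etaf x * k = s * x ^+ 2] with [s] equal to 1 or -1. Taking [x = t] shows that [k] is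
    nonzero, so [etaf x] is [s / k * x] for nonzero [x]. *)
Lemma eta_determined_linear E E' (etaf : R -> R) (t l : R) :
  (0 < n)%N -> t != 0 -> eta_determined E E' etaf ->
  etaf (l * t) = l * etaf t.
Proof.
move=> n0 t0 det; pose i0 := Ordinal n0; pose k := (E^T *m E') i0 i0.
have [s s0 hs] : exists2 s : R, s != 0 & forall x,
    x * etaf x * k = s * x ^+ 2 /\ (x = 0 -> etaf x *: E' = 0).
  have [s [s0 hs]] : exists s : R, s != 0 /\ forall x, exists2 S0,
      S0^T *m Jmx *m S0 = s *: Jmx & Smx E E' x (etaf x) = x *: S0.
    case: det => det; [exists 1 | exists (-1)];
      split; rewrite ?oppr_eq0 ?oner_eq0 //.
      by move=> x; have [S0 ? ?] := det x; exists S0; rewrite ?scale1r.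
    by move=> x; have [S0 ? ?] := det x; exists S0; rewrite ?scaleN1r.
  exists s => // x; have [S0 hS0 hx] := hs x; split.
    have kE : ((x * etaf x) *: (E^T *m E')) i0 i0 = x * etaf x * k.
      by rewrite mxE.
    have := Smx_form E E' x (etaf x).
    rewrite hx [(x *: S0)^T]linearZ /= -!scalemxAl -scalemxAr hS0 !scalerA.
    rewrite /Jmx scale_block_mx => /eq_block_mx[_ /matrixP/(_ i0 i0) + _ _].
    by rewrite kE !mxE eqxx mulr1 => <-; ring.
  by move=> x0; move: hx; rewrite x0 scale0r -block_mx0 => /eq_block_mx[].
have etaE x : x != 0 -> etaf x * k = s * x.
  by move=> x0; apply: (mulfI x0); rewrite mulrA (hs x).1; ring.
have k0 : k != 0.
  by apply: contra_neq (mulf_neq0 s0 t0) => k0; rewrite -etaE // k0 mulr0.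
(* At 0 the quadratic relation is void. There the matrix itself is 0 times some [S0], so
   [etaf 0 *: E' = 0], and [E'] is nonzero because [k] is. *)
have [->|l0] := eqVneq l 0; last first.
  by apply: (mulIf k0); rewrite -mulrA !etaE ?mulf_neq0 //; ring.
rewrite !mul0r; apply/eqP; have /eqP := (hs 0).2 erefl.
rewrite scaler_eq0 => /orP[//|/eqP E'0].
by move: k0; rewrite /k E'0 mulmx0 mxE eqxx.
Qed.

End Omega.

Theorem proposition1 (R : realType) (n : nat) (f : R -> R -> R -> R)
    (E E' : 'M[R]_n) (Sigma : 'M[R]_(n + n)) :
  (2 <= n)%N -> E \is skewmx -> E' \is skewmx -> Sigma \is symmetricmx ->
  (forall (hbar theta eta : R) (a : R[i]),
     eigenvalue (Cov Sigma f E E' hbar theta eta) a -> a \is Num.real)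
  /\
  (forall hbar theta eta : R,
     hbar != 0 -> theta != 0 -> eta != 0 ->
     HW_form (Omega f E E' hbar theta eta) ->
     up_to_scale symplectic theta (Smx E E' theta eta) \/
       up_to_scale antisymplectic theta (Smx E E' theta eta) ->
     psd (Cov Sigma f E E' hbar theta eta) ->
     posdef Sigma /\
     (forall etaf : R -> R,
        etaf theta = eta -> eta_determined E E' etaf ->
        homogeneous1 (fun h t => f h t (etaf t)) ->
        forall hbar' theta' : R,
          shrinks hbar' theta' hbar theta ->
          psd (Cov Sigma f E E' hbar' theta' (etaf theta')))).
Proof.
move=> n2 /skewmxT hE /skewmxT hE' symS; have hS := symmetricmxT symS.
have hO h t e := Omega_tr f h t e hE hE'.
split=> [h t e a | h t e h0 t0 _ hHW _ hpsd].
  apply: hermsym_eigenvalue_real.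
  exact: (hermitian_of_hermsym (@real_complex_real R)).
split.
  exact: psd_hermitian_of_posdef symS (hO h t e) (HW_form_unit hHW) hpsd.
move=> etaf etaft det homf h' t' [_ t't ht].
(* The preserved ratio puts the new parameters on the line through the old ones; [l] may be zero or
   negative. *)
have [l -> def_t'] : exists2 l, h' = l * h & t' = l * t.
  exists (t' / t); last by rewrite divfK.
  by apply: (mulIf t0); rewrite ht; field.
have l1 : `|l| <= 1.
  by rewrite -(ler_pM2r (_ : 0 < `|t|)) ?normr_gt0 // -normrM -def_t' mul1r.
have etal := eta_determined_linear l (ltnW n2) t0 det; rewrite etaft in etal.
(* Homogeneity is assumed only with [etaf] substituted for the third argument; linearity of [etaf]
   turns it into scaling of all three. *)
have fl : f (l * h) (l * t) (l * e) = l * f h t e by rewrite -etal homf etaft.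
rewrite def_t' etal /Cov (OmegaZ E E' fl).
exact: psd_hermitian_of_scale.
Qed.
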